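(* Let $\theta$ be a continuous real-valued function on a convex set $\mathcal{S}=\bigcup_{i=1}^I S^i$, where each $S^i$ is a closed convex set in $\mathbb{R}^N$. Suppose there exist $\mathrm{LC}^1$ functions $\theta_1,\dots,\theta_I$ defined on an open set $\mathcal{O}\subseteq\mathbb{R}^N$ containing $\mathcal{S}$ such that $\theta(x)=\theta_i(x)$ for all $x\in S^i$ and all $i$, and such that each difference function $\theta_{ji}(x)=\theta_j(x)-\theta_i(x)$ has dc gradients on $\mathcal{S}$ (that is, every component of $\nabla\theta_{ji}$ is a dc function on $\mathcal{S}$). Then $\theta$ is dc on $\mathcal{S}$.
   Context: A function on a convex set is dc (difference-of-convex) if it is the difference of two real-valued convex functions on that set. A function is $\mathrm{LC}^1$ on an open set $\mathcal{O}\subseteq\mathbb{R}^N$ if it is differentiable there and its gradient is a Lipschitz continuous function on $\mathcal{O}$. *)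

(* Defs.v *)
From HB Require Import structures.
From mathcomp Require Import all_boot all_order all_algebra.
From mathcomp Require Import all_classical all_reals all_analysis.

Set Implicit Arguments.
Unset Strict Implicit.
Unset Printing Implicit Defensive.

Import Order.TTheory GRing.Theory Num.Theory.
Import numFieldNormedType.Exports.

Local Open Scope classical_set_scope.
Local Open Scope ring_scope.

(* Functions on a subset of R^N are total; only their values on the set matter.
   R^N is 'rV[R]_N with the sup norm, which gives the same topology, the same
   derivatives and the same Lipschitz maps as the Euclidean norm. *)

Definition dc_on (R : realType) (N : nat) (S : set 'rV[R]_N)
    (f : 'rV[R]_N -> R) : Prop :=
  exists g h : 'rV[R]_N -> R,
    [/\ convex_function (S : set (convex_lmodType 'rV[R]_N)) g,
        convex_function (S : set (convex_lmodType 'rV[R]_N)) h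
      & forall x, S x -> f x = g x - h x].

Definition gradient (R : realType) (N : nat) (f : 'rV[R]_N -> R)
    (x : 'rV[R]_N) : 'rV[R]_N :=
  \row_(k < N) 'D_(delta_mx 0 k) f x.

Definition LC1_on (R : realType) (N : nat) (O : set 'rV[R]_N)
    (f : 'rV[R]_N -> R) : Prop :=
  (forall x, O x -> differentiable f x) /\
  [lipschitz gradient f x | x in O].

(* Main.v *)
Require Import Defs.
From HB Require Import structures.
From mathcomp Require Import all_boot all_order all_algebra.
From mathcomp Require Import all_classical all_reals all_analysis.
From mathcomp Require Import ring lra.

(* Let d_i(x) be the distance from x to S^i. Along a segment from x to a point y
   of S^i, theta is a continuous selection of the theta_j, whose gradients grow
   at most linearly, so |theta(x) - theta_i(x)| <= C (1 + |x| + |x - y|) |x - y|;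
   taking the infimum over y, theta is the pointwise minimum over the nonempty
   S^i of theta_i + C (1 + |x| + d_i) d_i. Each theta_i is dc because
   theta_i + c |x|^2 is convex for large c, the penalty is dc as a product of
   nonnegative convex functions, and finite minima of dc functions are dc. *)

Set Implicit Arguments.
Unset Strict Implicit.
Unset Printing Implicit Defensive.

Import Order.TTheory GRing.Theory Num.Theory.
Import numFieldNormedType.Exports.

Local Open Scope classical_set_scope.
Local Open Scope ring_scope.

(** * Elementary operations on convex functions *)

Section ConvexFunctions.
Variables (R : realType) (E : lmodType R).
Implicit Types (S : set (convex_lmodType E)) (f g : convex_lmodType E -> R^o).

(** Turns the bundled parameter [t] into a plain real with two inequalities, the form [lra] and
    [nra] can use. *)
Lemma convex_functionP S f :
  (forall (t : R) (x y : E), 0 <= t -> t <= 1 -> S x -> S y ->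
    f (t *: x + (1 - t) *: y) <= t * f x + (1 - t) * f y) <->
  convex_function S f.
Proof.
split=> [cf t x y /set_mem Sx /set_mem Sy|cf t x y t0 t1 Sx Sy].
  by apply: cf => //; case: (itvP t).
by have := cf (Itv01 t0 t1) x y; rewrite !inE; apply.
Qed.

Lemma convex_setP S :
  (forall (t : R) (x y : E), 0 <= t -> t <= 1 -> S x -> S y ->
    S (t *: x + (1 - t) *: y)) <-> convex_set S.
Proof.
split=> [cS x y t /set_mem Sx /set_mem Sy|cS t x y t0 t1 Sx Sy].
  by apply/mem_set; apply: cS => //; case: (itvP t).
by have := cS x y (Itv01 t0 t1); rewrite !inE; apply.
Qed.

Lemma convex_functionD S f g :
  convex_function S f -> convex_function S g ->
  convex_function S (fun x => f x + g x).
Proof.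
move=> /convex_functionP cf /convex_functionP cg; apply/convex_functionP.
move=> t x y t0 t1 Sx Sy.
have := cf t x y t0 t1 Sx Sy; have := cg t x y t0 t1 Sx Sy; lra.
Qed.

Lemma convex_function_cst S (c : R) : convex_function S (fun=> c).
Proof. by apply/convex_functionP => t x y t0 t1 _ _; lra. Qed.

Lemma convex_functionZ S f (c : R) : 0 <= c ->
  convex_function S f -> convex_function S (fun x => c * f x).
Proof.
move=> c0 /convex_functionP cf; apply/convex_functionP => t x y t0 t1 Sx Sy.
have := ler_wpM2l c0 (cf t x y t0 t1 Sx Sy); lra.
Qed.

Lemma convex_function_max S f g :
  convex_function S f -> convex_function S g ->
  convex_function S (fun x => Num.max (f x) (g x)).
Proof.
move=> /convex_functionP cf /convex_functionP cg; apply/convex_functionP.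
move=> t x y t0 t1 Sx Sy; rewrite ge_max; apply/andP; split.
  apply: le_trans (cf t x y t0 t1 Sx Sy) _.
  by apply: lerD; apply: ler_wpM2l; rewrite ?subr_ge0// le_max lexx.
apply: le_trans (cg t x y t0 t1 Sx Sy) _.
by apply: lerD; apply: ler_wpM2l; rewrite ?subr_ge0// le_max lexx orbT.
Qed.

Lemma convex_function_sqr S f : (forall x, 0 <= f x) ->
  convex_function S f -> convex_function S (fun x => f x ^+ 2).
Proof.
move=> f0 /convex_functionP cf; apply/convex_functionP => t x y t0 t1 Sx Sy.
have /= cfxy := cf t x y t0 t1 Sx Sy.
have : f (t *: x + (1 - t) *: y) ^+ 2 <= (t * f x + (1 - t) * f y) ^+ 2.
  by rewrite ler_sqr ?nnegrE ?f0//; apply: le_trans cfxy.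
(* This is the convexity gap of the square: [t a^2 + (1-t) b^2 - (t a + (1-t) b)^2 = t (1-t)
   (a-b)^2]. *)
have : 0 <= (t * (1 - t)) * (f x - f y) ^+ 2.
  by rewrite mulr_ge0 ?sqr_ge0// mulr_ge0 ?subr_ge0.
nra.
Qed.

End ConvexFunctions.

(** * Closure properties of dc functions *)

Section DifferenceOfConvex.
Variables (R : realType) (N : nat) (S : set 'rV[R]_N).
Implicit Types f g : 'rV[R]_N -> R.

Lemma eq_dc_on (f g : 'rV[R]_N -> R) : (forall x, S x -> f x = g x) -> dc_on S g -> dc_on S f.
Proof.
by move=> fg [a [b [ca cb gab]]]; exists a, b; split=> // x Sx; rewrite fg ?gab.
Qed.

Lemma dc_onD f g : dc_on S f -> dc_on S g -> dc_on S (fun x => f x + g x).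
Proof.
move=> [f1 [f2 [cf1 cf2 ff]]] [g1 [g2 [cg1 cg2 gg]]].
exists (fun x => f1 x + g1 x), (fun x => f2 x + g2 x).
split; try exact: convex_functionD.
by move=> x Sx; rewrite ff// gg//; ring.
Qed.

(** Rests on [min (f1 - f2) (g1 - g2) = (f1 + g1) - max (f2 + g1) (g2 + f1)]. *)
Lemma dc_on_min f g :
  dc_on S f -> dc_on S g -> dc_on S (fun x => Num.min (f x) (g x)).
Proof.
move=> [f1 [f2 [cf1 cf2 ff]]] [g1 [g2 [cg1 cg2 gg]]].
exists (fun x => f1 x + g1 x), (fun x => Num.max (f2 x + g1 x) (g2 x + f1 x)).
split; first exact: convex_functionD.
  by apply: convex_function_max; exact: convex_functionD.
move=> x Sx; rewrite ff// gg//.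
by case: (leP (f1 x - f2 x)) => ?; case: (leP (f2 x + g1 x)) => ?; lra.
Qed.

(* Polarization: u v = ((u + v)^2 - (u^2 + v^2)) / 2. *)
Lemma dc_on_mul_convex (u v : 'rV[R]_N -> R) :
  (forall x, 0 <= u x) -> (forall x, 0 <= v x) ->
  convex_function (S : set (convex_lmodType 'rV[R]_N)) u ->
  convex_function (S : set (convex_lmodType 'rV[R]_N)) v ->
  dc_on S (fun x => u x * v x).
Proof.
move=> u0 v0 cu cv.
exists (fun x => 2^-1 * (u x + v x) ^+ 2),
  (fun x => 2^-1 * (u x ^+ 2 + v x ^+ 2)); split.
- apply: convex_functionZ; first lra.
  apply: (@convex_function_sqr _ _ _ (fun x => u x + v x)).
    by move=> x; rewrite addr_ge0.
  exact: convex_functionD.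
- apply: convex_functionZ; first lra.
  by apply: convex_functionD; apply: convex_function_sqr.
- by move=> x _; field.
Qed.

(** Iterates binary minima along the list, written [i0 :: s] because an empty family has no
    minimum. *)
Lemma dc_on_seq_min (I : eqType) (i0 : I) (s : seq I)
    (f_ : I -> 'rV[R]_N -> R) :
  (forall i, i \in i0 :: s -> dc_on S (f_ i)) ->
  exists m, [/\ dc_on S m, forall x i, i \in i0 :: s -> m x <= f_ i x
    & forall x, exists2 i, i \in i0 :: s & m x = f_ i x].
Proof.
elim: s i0 => [|i s IH] i0 dcf.
  exists (f_ i0); split; first by apply: dcf; rewrite mem_head.
    by move=> x j; rewrite inE => /eqP->.
  by move=> x; exists i0; rewrite // mem_head.
have [m [dcm mle matt]] := IH i (fun j js => dcf j (mem_behead (s := i0 :: _) js)).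
exists (fun x => Num.min (f_ i0 x) (m x)); split.
- by apply: dc_on_min => //; apply: dcf; rewrite mem_head.
- move=> x j; rewrite inE ge_min => /predU1P[->|/(mle x) ->].
    by rewrite lexx.
  by rewrite orbT.
- move=> x; case: leP => _; first by exists i0; rewrite // mem_head.
  by have [j js ->] := matt x; exists j; rewrite // inE js orbT.
Qed.

Lemma dc_on_pointwise_min (I : eqType) (s : seq I) (f_ : I -> 'rV[R]_N -> R)
    (f : 'rV[R]_N -> R) :
  (forall i, i \in s -> dc_on S (f_ i)) ->
  (forall x i, S x -> i \in s -> f x <= f_ i x) ->
  (forall x, S x -> exists2 i, i \in s & f_ i x = f x) ->
  dc_on S f.
Proof.
case: s => [|i0 s] dcf flb fatt.
  (* With no index available, [fatt] forces [S] to be empty. *)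
  exists (fun=> 0), (fun=> 0); split; try exact: convex_function_cst.
  by move=> x /fatt[].
have [m [dcm mle matt]] := dc_on_seq_min dcf.
apply: eq_dc_on dcm => x Sx; apply/eqP; rewrite eq_le; apply/andP; split.
  by have [j js ->] := matt x; exact: flb.
by have [j js <-] := fatt x Sx; exact: mle.
Qed.

End DifferenceOfConvex.

(** * Convexity of the norm and of the distance to a convex set *)

Lemma convex_norm (R : realType) (V : normedModType R) (D : set V) :
  convex_function (D : set (convex_lmodType V)) (fun x : V => `|x|).
Proof.
apply/convex_functionP => t x y t0 t1 _ _; apply: (le_trans (ler_normD _ _)).
by rewrite !normrZ !ger0_norm ?subr_ge0.
Qed.

Section Distance.
Variables (R : realType) (V : normedModType R) (A : set V).

Definition dist_set (x : V) : R := inf [set `|x - a| | a in A].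

Lemma dist_set_le x a : A a -> dist_set x <= `|x - a|.
Proof.
by move=> Aa; apply: ge_inf; [exists 0 => _ [b _ <-]|exists a].
Qed.

Lemma dist_set_ge0 x : 0 <= dist_set x.
Proof.
have [[a Aa]|/set0P/negP/negPn/eqP A0] := pselect (A !=set0).
  by apply: lb_le_inf => [|_ [b _ <-]]; first by exists `|x - a|, a.
by rewrite /dist_set A0 image_set0 inf0.
Qed.

Lemma dist_set0 x : A x -> dist_set x = 0.
Proof.
move=> Ax; apply/eqP; rewrite eq_le dist_set_ge0 andbT.
by rewrite -(normr0 V) -(subrr x) dist_set_le.
Qed.

Hypothesis A_neq0 : A !=set0.

Lemma dist_set_adherent x e : 0 < e ->
  exists2 a, A a & `|x - a| < dist_set x + e.
Proof.
move=> e0; have [|_ [a Aa <-]] := @inf_adherent _ [set `|x - a| | a in A] _ e0.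
  by split; [case: A_neq0 => a Aa; exists `|x - a|, a|exists 0 => _ [b _ <-]].
by exists a.
Qed.

(** Near-minimisers [a] for [x] and [b] for [y] combine, by convexity of [A], into a point of [A]
    whose distance to the combination of [x] and [y] exceeds the required bound by at most [e]. *)
Lemma convex_dist_set (D : set V) :
  convex_set (A : set (convex_lmodType V)) ->
  convex_function (D : set (convex_lmodType V)) dist_set.
Proof.
move=> /convex_setP cA; apply/convex_functionP => t x y t0 t1 _ _.
apply/ler_addgt0Pr => e e0.
have [a Aa xa] := dist_set_adherent x e0.
have [b Ab yb] := dist_set_adherent y e0.
apply: (le_trans (dist_set_le _ (cA t a b t0 t1 Aa Ab))).
have -> : t *: x + (1 - t) *: y - (t *: a + (1 - t) *: b)
    = t *: (x - a) + (1 - t) *: (y - b).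
  by rewrite !scalerBr opprD addrACA.
apply: (le_trans (ler_normD _ _)); rewrite !normrZ !ger0_norm ?subr_ge0//.
have := ler_wpM2l t0 (ltW xa).
have : (1 - t) * `|y - b| <= (1 - t) * (dist_set y + e).
  by rewrite ler_wpM2l ?subr_ge0// ltW.
lra.
Qed.

End Distance.

(** * Continuous selections of finitely many Lipschitz functions *)

Section LipschitzSelection.
Variable R : realType.

(** Continuous induction, since [g] may switch pieces infinitely often: the set of [t] with
    [|g t - g 0| <= M t] contains 0, contains its supremum by continuity of [g], and extends to the
    right of that supremum as long as it is below 1. *)
Lemma lipschitz_selection (I : finType) (g : R -> R) (h : I -> R -> R) (M : R) :
  0 <= M ->
  (forall t, 0 <= t <= 1 -> exists i, g t = h i t) ->
  (forall i s t, 0 <= s <= 1 -> 0 <= t <= 1 -> `|h i t - h i s| <= M * `|t - s|) ->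
  (forall s e, 0 <= s <= 1 -> 0 < e ->
    exists2 d, 0 < d & forall t, 0 <= t <= 1 -> `|t - s| < d -> `|g t - g s| < e) ->
  `|g 1 - g 0| <= M.
Proof.
move=> M0 gh hM cg.
(* Immediately to the right of s, g only follows pieces h i with h i s = g s. *)
have right_step s : 0 <= s < 1 ->
    exists t, s < t <= 1 /\ `|g t - g s| <= M * (t - s).
  move=> /andP[s0 s1]; have s01 : 0 <= s <= 1 by rewrite s0 ltW.
  have near_i i : \forall t \near s^'+, t <= 1 /\
      (h i t = g t -> h i s = g s).
    have [his|his] := pselect (h i s = g s).
      near=> t; split=> //; apply/ltW; near: t; exact: nbhs_right_lt.
    (* Here [h i] and [g] are [2 e] apart at [s]. Just to the right of [s], [h i] moves by at most
       [e] and [g] by less than [e], so they cannot meet. Dividing by [M + 1] below covers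
       [M = 0]. *)
    pose e := `|h i s - g s| / 2.
    have e0 : 0 < e by rewrite divr_gt0 ?normr_gt0 ?subr_eq0//; apply/eqP.
    have [d d0 dg] := cg s e s01 e0.
    near=> t.
    have st : s < t by near: t; exact: nbhs_right_gt.
    have t1 : t < 1 by near: t; exact: nbhs_right_lt.
    have td : t < s + d by near: t; apply: nbhs_right_lt; rewrite ltrDl.
    have tM : t < s + e / (M + 1).
      near: t; apply: nbhs_right_lt; rewrite ltrDl divr_gt0//; lra.
    have t01 : 0 <= t <= 1 by lra.
    split=> [|hit]; first exact: ltW.
    have gts : `|g t - g s| < e by apply: dg => //; rewrite gtr0_norm; lra.
    have := hM i s t s01 t01; rewrite (@gtr0_norm _ (t - s)) ?subr_gt0// => hts.
    have Me : M * (t - s) <= e.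
      have : t - s < e / (M + 1) by lra.
      rewrite ltr_pdivlMr; last lra.
      lra.
    have : `|h i s - g s| <= `|h i t - h i s| + `|g t - g s|.
      rewrite hit (distrC (g t) (h i s)); exact: ler_distD.
    by move: (e0) (gts) (Me) (hts); rewrite /e; lra.
  (* Finiteness of [I] yields one right neighbourhood that serves all pieces. *)
  have : \forall t \near s^'+,
      s < t /\ forall i, t <= 1 /\ (h i t = g t -> h i s = g s).
    by apply: filterI; [exact: nbhs_right_gt|exact: (filter_forall _ near_i)].
  move=> /filter_ex[t [st near_t]].
  (* Some index is needed to extract [t <= 1], which sits under the quantifier over [i]. *)
  have [i0 _] := gh s s01.
  have t1 := (near_t i0).1; exists t; split; first by rewrite st.
  have t01 : 0 <= t <= 1 by lra.
  have [i gti] := gh t t01.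
  rewrite gti -((near_t i).2 (esym gti)).
  by apply: (le_trans (hM i s t s01 t01)); rewrite (@gtr0_norm _ (t - s)) ?subr_gt0.
pose A := [set t : R | 0 <= t <= 1 /\ `|g t - g 0| <= M * t].
have A0 : A 0 by split; [rewrite lexx ler01|rewrite subrr normr0 mulr0].
have ubA : has_ubound A by exists 1 => t [/andP[]].
have supA : has_sup A by split; [exists 0|].
pose s := sup A.
have s0 : 0 <= s by exact: ub_le_sup.
have s1 : s <= 1 by apply: ge_sup => [|t [/andP[]]//]; exists 0.
have s01 : 0 <= s <= 1 by rewrite s0.
have As : `|g s - g 0| <= M * s.
  apply/ler_addgt0Pr => e e0.
  have [d d0 dg] := cg s e s01 e0.
  have [t [t01 At] st] := sup_adherent d0 supA.
  have ts : t <= s by apply: ub_le_sup => //; split.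
  have := dg t t01; rewrite ler0_norm ?subr_le0// => /(_ _)/wrap[].
    by move: st; rewrite -/s; lra.
  rewrite (distrC (g t)) => gst.
  apply: (le_trans (ler_distD (g t) _ _)).
  have := ler_wpM2l M0 ts; lra.
have [s1'|] := ltP s 1; last first.
  by move=> s1'; have <- : s = 1 by [lra]; rewrite (le_trans As)//; nra.
have [|t [/andP[st t1] gts]] := right_step s; first by rewrite s0.
suff : A t by move=> /(ub_le_sup ubA); rewrite -/s leNgt st.
split; first lra.
by have := ler_distD (g s) (g t) (g 0); lra.
Unshelve. all: by end_near. Qed.

End LipschitzSelection.

(** * Gradients, the mean value theorem and subgradient inequalities *)

Section Gradients.
Variables (R : realType) (N : nat).
Implicit Types (f : 'rV[R]_N -> R) (x y z v : 'rV[R]_N) (S O : set 'rV[R]_N).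

Lemma coord_le_norm v k : `|v 0 k| <= `|v|.
Proof.
by rewrite [leRHS]/Num.Def.normr /= mx_normrE; apply/bigmax_geP; right; exists (0, k).
Qed.

(** The factor [N] is the price of using the sup norm on both sides. *)
Lemma dot_le (u v : 'rV[R]_N) : `|\sum_k u 0 k * v 0 k| <= N%:R * (`|u| * `|v|).
Proof.
apply: (le_trans (ler_norm_sum _ _ _)).
have -> : N%:R * (`|u| * `|v|) = \sum_(k < N) `|u| * `|v|.
  by rewrite sumr_const card_ord mulr_natl.
by apply: ler_sum => k _; rewrite normrM ler_pM ?coord_le_norm.
Qed.

Lemma derive_gradient f x v : differentiable f x ->
  'D_v f x = \sum_k gradient f x 0 k * v 0 k.
Proof.
move=> df; rewrite deriveE// {1}(row_sum_delta v) linear_sum.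
by apply: eq_bigr => k _; rewrite linearZ mxE deriveE// mulrC.
Qed.

Lemma mean_value_gradient f x v :
  (forall t, 0 <= t <= 1 -> differentiable f (x + t *: v)) ->
  exists2 c, 0 <= c <= 1 &
    f (x + v) - f x = \sum_k gradient f (x + c *: v) 0 k * v 0 k.
Proof.
move=> df; pose phi t := f (x + t *: v).
(* The difference quotients of [phi] at [t] are those of [f] at [x + t *: v] along [v], so
   derivatives transfer without a chain rule. *)
have quotE (t : R) :
    (fun h : R => h^-1 *: ((phi \o shift t) (h *: (1 : R)) - phi t)) =
    (fun h : R => h^-1 *: ((f \o shift (x + t *: v)) (h *: v) - f (x + t *: v))).
  apply/funext => h; rewrite /phi /=; congr (_ *: (f _ - _)).
  by rewrite [h *: 1]mulr1 scalerDl addrCA.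
have dphi (t : R) : 0 <= t <= 1 ->
    is_derive t (1 : R) phi (\sum_k gradient f (x + t *: v) 0 k * v 0 k).
  move=> t01; have dft := df t t01; apply: DeriveDef.
    by rewrite /derivable quotE; exact: diff_derivable.
  by rewrite /derive quotE -derive_gradient.
have [t||c] := @MVT_segment R phi
  (fun t => \sum_k gradient f (x + t *: v) 0 k * v 0 k) 0 1 (@ler01 R).
- by rewrite in_itv /= => /andP[t0 t1]; apply: dphi; rewrite !ltW.
- apply: derivable_within_continuous => t; rewrite in_itv /= => t01.
  by have [] := dphi t t01.
- rewrite in_itv /= => c01 e; exists c => //.
  by move: e; rewrite /phi scale1r scale0r addr0 subr0 mulr1.
Qed.

(** The supporting inequality at [z = t x + (1-t) y] is applied to [x] and [y]; the linear terms
    cancel because [t (x-z) + (1-t) (y-z) = 0]. *)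
Lemma subgradient_convex S f :
  (forall x, S x -> exists p : 'rV[R]_N,
     forall y, S y -> f x + \sum_k p 0 k * (y - x) 0 k <= f y) ->
  convex_set (S : set (convex_lmodType 'rV[R]_N)) ->
  convex_function (S : set (convex_lmodType 'rV[R]_N)) f.
Proof.
move=> fsub /convex_setP cS; apply/convex_functionP => t x y t0 t1 Sx Sy.
have [p fp] := fsub _ (cS t x y t0 t1 Sx Sy).
set z := _ + _ in fp *.
have := ler_wpM2l t0 (fp x Sx).
have : (1 - t) * (f z + \sum_k p 0 k * (y - z) 0 k) <= (1 - t) * f y.
  by rewrite ler_wpM2l ?subr_ge0// fp.
have : t * (\sum_k p 0 k * (x - z) 0 k) +
    (1 - t) * (\sum_k p 0 k * (y - z) 0 k) = 0.
  rewrite !mulr_sumr -big_split /= big1// => k _.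
  by rewrite /z !mxE; ring.
lra.
Qed.

(** The library's Lipschitz condition speaks of all sufficiently large constants; a nonnegative one
    is picked. *)
Lemma LC1_onP O f : LC1_on O f ->
  (forall x, O x -> differentiable f x) /\
  exists2 L, 0 <= L & forall x y, O x -> O y ->
    `|gradient f x - gradient f y| <= L * `|x - y|.
Proof.
move=> [df lipf]; split=> //.
have [L [L0 lipL]] : exists L : R, 0 <= L /\
    dominated_by (self_sub id) L (self_sub (gradient f)) (globally (O `*` O)).
  near (pinfty_nbhs R) => L; exists L; split; near: L; last exact: lipf.
  exact: nbhs_pinfty_ge.
by exists L => // x y Ox Oy; exact: (lipL (x, y)).
Unshelve. all: by end_near. Qed.

(** The squared Euclidean norm: unlike the squared sup norm, it has an exact second-order
    expansion. *)
Let sqn x : R := \sum_k x 0 k ^+ 2.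

Lemma sqnD x v : sqn (x + v) = sqn x + \sum_k (2 * x 0 k) * v 0 k + sqn v.
Proof.
rewrite /sqn -!big_split; apply: eq_bigr => k _ /=; rewrite !mxE; ring.
Qed.

Lemma sqr_norm_le_sqn v : `|v| ^+ 2 <= sqn v.
Proof.
have sqn0 : 0 <= sqn v by apply: sumr_ge0 => k _; exact: sqr_ge0.
have [->|] := eqVneq `|v| 0; first by rewrite expr0n.
move=> /mx_norm_neq0[[i k] /= vk]; rewrite {1}/Num.Def.normr /= vk (ord1 i).
rewrite real_normK ?num_real// /sqn (bigD1 k)//= lerDl.
by apply: sumr_ge0 => j _; exact: sqr_ge0.
Qed.

(* f + c |x|^2 satisfies the subgradient inequality once c >= N L, where L is
   a Lipschitz constant of the gradient for the sup norm. *)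
Lemma LC1_dc_on S O f :
  convex_set (S : set (convex_lmodType 'rV[R]_N)) -> S `<=` O ->
  LC1_on O f -> dc_on S f.
Proof.
move=> cS SO /LC1_onP[df [L L0 lipf]].
pose c := N%:R * L; have c0 : 0 <= c by rewrite mulr_ge0.
exists (fun x => f x + c * sqn x), (fun x => c * sqn x); split; last 1 first.
- by move=> x _; rewrite addrK.
- apply: subgradient_convex (cS) => x Sx.
  (* The gradient of [f + c * sqn] at [x]. *)
  exists (gradient f x + (2 * c) *: x) => y Sy.
  set v := y - x; have -> : y = x + v by rewrite /v addrC subrK.
  have Sxv t : 0 <= t <= 1 -> S (x + t *: v).
    move=> /andP[t0 t1]; move/convex_setP : cS => /(_ t y x t0 t1 Sy Sx).
    by congr S; apply/rowP => k; rewrite !mxE; ring.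
  have [|t t01 fE] := @mean_value_gradient f x v.
    by move=> t t01; exact/df/SO/Sxv.
  (* By the choice of [t], this sum is the first-order Taylor remainder of [f]; the term [c * sqn v]
     of the expansion of [c * sqn] compensates for it. *)
  have : `|\sum_k (gradient f (x + t *: v) - gradient f x) 0 k * v 0 k|
      <= c * sqn v.
    apply: (le_trans (dot_le _ _)).
    rewrite -mulrA ler_wpM2l//.
    apply: (@le_trans _ _ (L * `|v| * `|v|)).
      apply: ler_wpM2r => //.
      apply: (le_trans (lipf _ _ (SO _ (Sxv t t01)) (SO _ Sx))).
      rewrite ler_wpM2l// addrAC subrr add0r normrZ.
      by case/andP: t01 => t0 t1; rewrite ger0_norm// ler_piMl.
    by rewrite -mulrA -expr2 ler_wpM2l// sqr_norm_le_sqn.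
  have -> : \sum_k (gradient f (x + t *: v) - gradient f x) 0 k * v 0 k =
      f (x + v) - f x - \sum_k gradient f x 0 k * v 0 k.
    rewrite fE -sumrB; apply: eq_bigr => k _.
    by rewrite !mxE; ring.
  have -> : \sum_k (gradient f x + (2 * c) *: x) 0 k * v 0 k =
     \sum_k gradient f x 0 k * v 0 k + c * \sum_k (2 * x 0 k) * v 0 k.
    rewrite mulr_sumr -big_split; apply: eq_bigr => k _ /=.
    by rewrite !mxE; ring.
  by rewrite sqnD ler_norml => /andP[+ _]; lra.
- apply: subgradient_convex (cS) => x Sx.
  exists ((2 * c) *: x) => y Sy.
  have {2}-> : y = x + (y - x) by rewrite addrC subrK.
  rewrite sqnD.
  have -> : \sum_k ((2 * c) *: x) 0 k * (y - x) 0 k =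
     c * \sum_k (2 * x 0 k) * (y - x) 0 k.
    rewrite mulr_sumr; apply: eq_bigr => k _ /=.
    by rewrite !mxE; ring.
  have : 0 <= c * sqn (y - x).
    by rewrite mulr_ge0// sumr_ge0// => k _; exact: sqr_ge0.
  lra.
Qed.

(** Compare with the gradient at a fixed base point [x0]; [O] may be unbounded, so the bound has to
    grow with [x]. *)
Lemma LC1_gradient_growth O f : LC1_on O f ->
  exists2 K, 0 <= K & forall x, O x -> `|gradient f x| <= K * (1 + `|x|).
Proof.
move=> /LC1_onP[_ [L L0 lipf]].
have [[x0 Ox0]|O0] := pselect (O !=set0); last first.
  by exists 0 => // x Ox; case: O0; exists x.
exists (`|gradient f x0| + L * (1 + `|x0|)) => [|x Ox].
  by rewrite addr_ge0// mulr_ge0// addr_ge0.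
rewrite -[gradient f x](subrK (gradient f x0)).
apply: (le_trans (ler_normD _ _)).
have := lipf x x0 Ox Ox0.
have := ler_wpM2l L0 (ler_normB x x0).
have : 0 <= `|gradient f x0| * `|x| by rewrite mulr_ge0.
have : 0 <= L * (`|x0| * `|x|) by rewrite !mulr_ge0.
lra.
Qed.

End Gradients.

(** * Estimates along segments and limiting arguments *)

Lemma segment_lipschitz (R : realType) (N : nat) (S : set 'rV[R]_N)
    (f : 'rV[R]_N -> R) (x v : 'rV[R]_N) (K s t : R) :
  0 <= K ->
  (forall z, S z -> differentiable f z) ->
  (forall z, S z -> `|gradient f z| <= K * (1 + `|z|)) ->
  (forall t, 0 <= t <= 1 -> S (x + t *: v)) ->
  0 <= s <= 1 -> 0 <= t <= 1 ->
  `|f (x + t *: v) - f (x + s *: v)|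
    <= N%:R * (K * (1 + `|x| + `|v|) * `|v|) * `|t - s|.
Proof.
move=> K0 df gradK Sseg /andP[s0 s1] /andP[t0 t1].
(* The mean value theorem runs from [x + s *: v] along [(t - s) *: v]; in either order of [s] and
   [t], its intermediate point stays on the original segment. *)
have subseg c : 0 <= c <= 1 ->
    0 <= s + c * (t - s) <= 1 /\
    x + s *: v + c *: ((t - s) *: v) = x + (s + c * (t - s)) *: v.
  move=> /andP[c0 c1]; split; last by rewrite scalerA scalerDl addrA.
  by apply/andP; split; nra.
have [c /subseg[c01 cE]|c /subseg[/andP[r0 r1] cE]] :=
    @mean_value_gradient _ _ f (x + s *: v) ((t - s) *: v).
  by rewrite cE; exact/df/Sseg.
have -> : x + s *: v + (t - s) *: v = x + t *: v.
  by rewrite -addrA -scalerDl [s + _]addrC subrK.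
rewrite cE => ->; set r := s + c * (t - s) in r0 r1 *.
apply: (le_trans (dot_le _ _)); rewrite normrZ -!mulrA ler_wpM2l//.
rewrite [`|t - s| * _]mulrC !mulrA !ler_wpM2r//.
apply: (le_trans (gradK _ (Sseg _ _))); first by rewrite r0.
rewrite ler_wpM2l// -addrA lerD2l (le_trans (ler_normD _ _))// lerD2l normrZ.
by rewrite ger0_norm// ler_piMl.
Qed.

Lemma le_of_forall_quadratic (R : realFieldType) (a b c d : R) :
  0 <= b -> 0 <= c -> 0 <= d ->
  (forall e, 0 < e -> a <= c * (b + (d + e)) * (d + e)) ->
  a <= c * (b + d) * d.
Proof.
move=> b0 c0 d0 ae; apply/ler_addgt0Pr => e e0.
(* Replacing [d] by [d + u] raises the bound by [c u (b + 2 d + u)], at most [u * D] when [u <= 1];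
   the final 1 keeps [D] positive. *)
pose D := c * (b + 2 * d + 1) + 1.
have D0 : 0 < D by rewrite ltr_wpDl// mulr_ge0//; lra.
pose u := Num.min 1 (e / D).
have u0 : 0 < u by rewrite lt_min ltr01 divr_gt0.
have u1 : u <= 1 by rewrite ge_min lexx.
have uD : u * D <= e by rewrite -ler_pdivlMr// ge_min lexx orbT.
apply: (le_trans (ae u u0)).
have : 0 <= (c * u) * (1 - u) by rewrite !mulr_ge0 ?subr_ge0// ltW.
by move: uD; rewrite /D; lra.
Qed.

Lemma within_continuous_dist (R : realType) (V : normedModType R) (S : set V)
    (f : V -> R) (x : V) (e : R) :
  {within S, continuous f} -> S x -> 0 < e ->
  exists2 d, 0 < d & forall y, S y -> `|y - x| < d -> `|f y - f x| < e.
Proof.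
move=> cf Sx e0.
have /cvgrPdist_lt /(_ e e0) : f @ within S (nbhs x) --> f x.
  by move/subspace_continuousP : cf; exact.
move=> /nbhs_ballP[d /= d0 xd].
exists d => // y Sy yx; rewrite distrC; apply: xd => //.
by rewrite -ball_normE /= distrC.
Qed.

Theorem proposition11 (R : realType) (N I : nat)
    (S : set 'rV[R]_N) (S_ : 'I_I -> set 'rV[R]_N)
    (convS : convex_set (S : set (convex_lmodType 'rV[R]_N)))
    (closedS_ : forall i, closed (S_ i))
    (convS_ : forall i, convex_set (S_ i : set (convex_lmodType 'rV[R]_N)))
    (S_cover : S = \bigcup_i S_ i)
    (theta : 'rV[R]_N -> R)
    (cont_theta : {within S, continuous theta})
    (O : set 'rV[R]_N) (openO : open O) (SO : S `<=` O)
    (theta_ : 'I_I -> 'rV[R]_N -> R)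
    (LC1_theta_ : forall i, LC1_on O (theta_ i))
    (theta_E : forall i x, S_ i x -> theta x = theta_ i x)
    (dc_grad : forall (i j : 'I_I) (k : 'I_N),
       dc_on S (fun x => gradient (theta_ j \- theta_ i) x 0 k)) :
  dc_on S theta.
Proof.
have S_S i : S_ i `<=` S by rewrite S_cover => x Sx; exists i.
have dtheta i z : S z -> differentiable (theta_ i) z.
  by move=> /SO; exact: (LC1_theta_ i).1.
have [K K0 gradK] : exists2 K, 0 <= K &
    forall i z, S z -> `|gradient (theta_ i) z| <= K * (1 + `|z|).
  have /choice[k kP] i : exists k, 0 <= k /\
      forall z, O z -> `|gradient (theta_ i) z| <= k * (1 + `|z|).
    by have [k k0 kP] := LC1_gradient_growth (LC1_theta_ i); exists k.
  (* The sum of the nonnegative constants dominates each of them. *)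
  exists (\sum_i k i) => [|i z /SO Oz].
    by apply: sumr_ge0 => i _; exact: (kP i).1.
  apply: (le_trans ((kP i).2 z Oz)); rewrite ler_wpM2r ?addr_ge0//.
  by rewrite (bigD1 i)//= lerDl sumr_ge0// => j _; exact: (kP j).1.
pose M (x v : 'rV[R]_N) := N%:R * (K * (1 + `|x| + `|v|) * `|v|).
(* Since [theta] and [theta_ i] agree at [y], the gap at [x] is at most the sum of their variations
   along the segment, each at most [M x (y - x)]. The segment stays in [S], possibly outside
   [S_ i]. *)
have gap i x y : S x -> S_ i y -> `|theta x - theta_ i x| <= 2 * M x (y - x).
  move=> Sx Siy; have Sy := S_S i y Siy; set v := y - x.
  have xv : x + 1 *: v = y by rewrite scale1r /v addrC subrK.
  have Sseg t : 0 <= t <= 1 -> S (x + t *: v).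
    move=> /andP[t0 t1]; move/convex_setP : convS => /(_ t y x t0 t1 Sy Sx).
    by congr S; apply/rowP => k; rewrite !mxE; ring.
  have M0 : 0 <= M x v by rewrite !mulr_ge0// !addr_ge0.
  have lip j s t : 0 <= s <= 1 -> 0 <= t <= 1 ->
      `|theta_ j (x + t *: v) - theta_ j (x + s *: v)| <= M x v * `|t - s|.
    exact: (segment_lipschitz K0 (dtheta j) (gradK j) Sseg).
  have := lip i 0 1; rewrite !(lexx, ler01) subr0 normr1 mulr1 => /(_ isT isT).
  have : `|theta (x + 1 *: v) - theta (x + 0 *: v)| <= M x v.
    apply: (@lipschitz_selection R _ (fun t => theta (x + t *: v))
      (fun j t => theta_ j (x + t *: v))) => //.
    - by move=> t /Sseg; rewrite S_cover => -[j _ /theta_E]; exists j.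
    - move=> s e s01 e0.
      have [d d0 dP] := within_continuous_dist cont_theta (Sseg s s01) e0.
      (* Adding 1 covers [v = 0]. *)
      exists (d / (`|v| + 1)) => [|t t01 ts]; first by rewrite divr_gt0// ltr_wpDl.
      apply: dP; first exact: Sseg.
      rewrite opprD addrACA subrr add0r -scalerBl normrZ.
      move: ts; rewrite ltr_pdivlMr ?ltr_wpDl// mulrDr mulr1.
      by apply: le_lt_trans; rewrite lerDl.
  rewrite xv scale0r addr0 (theta_E i y Siy) => thx thix.
  apply: (le_trans (ler_distD (theta_ i y) _ _)).
  by rewrite mulr2n mulrDl mul1r lerD// distrC.
(* This is the bound [2 * M x (y - x)] with the distance to [S_ i] in place of the norm of
   [y - x]. *)
pose pen i x := 2 * N%:R * K * (1 + `|x| + dist_set (S_ i) x) * dist_set (S_ i) x.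
(* Empty pieces must be dropped: dist_set is 0 (junk) for them. *)
pose s := [seq i <- enum 'I_I | `[< S_ i !=set0 >]].
apply: (@dc_on_pointwise_min _ _ _ _ s (fun i x => theta_ i x + pen i x)).
- move=> i; rewrite mem_filter => /andP[/asboolP Si0 _].
  apply: dc_onD; first exact: LC1_dc_on (LC1_theta_ i).
  have cdist := @convex_dist_set _ _ _ Si0 S (convS_ i).
  apply: dc_on_mul_convex => //; try exact: dist_set_ge0.
    by move=> x; rewrite !mulr_ge0// !addr_ge0// dist_set_ge0.
  apply: convex_functionZ; first by rewrite !mulr_ge0.
  apply: convex_functionD => //; apply: convex_functionD.
    exact: convex_function_cst.
  exact: convex_norm.
- move=> x i Sx; rewrite mem_filter => /andP[/asboolP Si0 _].
  rewrite -lerBlDl (le_trans (ler_norm _))//.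
  (* Taken with [1 + |x|] as [b] and the distance as [d]: near-minimisers [y] in [S_ i] then
     suffice. *)
  apply: le_of_forall_quadratic; rewrite ?dist_set_ge0 ?addr_ge0 ?mulr_ge0//.
  move=> e e0; have [y Siy xy] := dist_set_adherent Si0 x e0.
  apply: (le_trans (gap i x y Sx Siy)).
  rewrite /M (distrC y) !mulrA ler_pM// ?mulr_ge0 ?addr_ge0 ?(ltW xy)//.
  by rewrite ler_wpM2l ?mulr_ge0// lerD2l ltW.
(* On a piece containing [x] the penalty vanishes, so the minimum is attained there. *)
- move=> x; rewrite {1}S_cover => -[i _ Six]; exists i.
    by rewrite mem_filter mem_enum andbT; apply/asboolP; exists x.
  by rewrite /pen (dist_set0 Six) mulr0 addr0 -theta_E.
Qed.
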